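(* Let $n\ge3$, let $P$ be a positive-area local optimum with $\Delta=\delta(P)$, and let $\theta=(\lambda,\ell,r,d,u)$ be a normalized KKT multiplier at $P$. Let $\mathcal H$ be any subfamily of the set of tight triangles, and put $$B_{\mathcal H}=\sum_{t\in\mathcal H}\lambda_tB_t,\qquad m_{\mathcal H}=\sum_{t\in\mathcal H}\lambda_t .$$ Define $b^{\mathcal H}_i\in\mathbb R^2$ (identified with $\mathbb C$), $i\in[n]$, by $B_{\mathcal H}z=2\mathrm i\,b^{\mathcal H}$, where $z=(x_i+\mathrm i y_i)_i\in\mathbb C^n$. Then, viewing $p_i$ and $b_i^{\mathcal H}$ as column vectors in $\mathbb R^2$, $$\sum_i b_i^{\mathcal H}=0,\qquad \sum_i p_i(b_i^{\mathcal H})^T=m_{\mathcal H}\,\Delta\, I_2 .$$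
   Context: A configuration is $P=(p_1,\dots,p_n)$ with $p_i=(x_i,y_i)\in[0,1]^2$. For a triple $t=(i,j,k)$, $i<j<k$, put $D_t(P)=\det(p_j-p_i,p_k-p_i)$, $A_t(P)=\tfrac12|D_t(P)|$, and $\delta(P)=\min_tA_t(P)$. A positive-area local optimum is a local maximizer $P$ of $\delta$ on $([0,1]^2)^n$ with $\Delta:=\delta(P)>0$. A triangle $t$ is tight (active) if $A_t(P)=\Delta$. Put $s_t=\operatorname{sgn}D_t(P)$; near $P$, $A_t=\tfrac12s_tD_t$, which is used for derivatives. A normalized KKT multiplier at $P$ is a tuple of nonnegative reals $\lambda_t$ (all triples $t$), $\ell_i,r_i,d_i,u_i$ ($i\in[n]$) with: $\lambda_t=0$ unless $t$ is tight; $\ell_i=0$ unless $x_i=0$, $r_i=0$ unless $x_i=1$, $d_i=0$ unless $y_i=0$, $u_i=0$ unless $y_i=1$; $\sum_t\lambda_t=1$; and $\sum_t\lambda_t\nabla_{p_i}A_t(P)+(\ell_i-r_i,d_i-u_i)=0$ for all $i$. For $t=(i,j,k)$, $i<j<k$, the elementary stress is the $n\times n$ matrix $B_t=s_t(a_tc_t^T-c_ta_t^T)$ with $a_t=e_j-e_i$, $c_t=e_k-e_i$ ($e_i$ the standard basis of $\mathbb R^n$). *)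

(* Defs.v *)
From mathcomp Require Import all_boot all_order all_algebra.
From mathcomp Require Import all_classical all_reals all_analysis.
From mathcomp Require Export complex.

Set Implicit Arguments.
Unset Strict Implicit.
Unset Printing Implicit Defensive.

Import Order.TTheory GRing.Theory Num.Theory.
Import numFieldNormedType.Exports.

Local Open Scope ring_scope.
Local Open Scope classical_set_scope.

(* A configuration of n points is an n x 2 real matrix P whose row i is
   p_i = (x_i, y_i): x_i = P i 0 and y_i = P i 1. *)

Definition vertex (R : realType) (n : nat) (P : 'M[R]_(n, 2)) (i : 'I_n)
    : 'cV[R]_2 :=
  (row i P)^T.

Definition in_unit_square (R : realType) (n : nat) (P : 'M[R]_(n, 2)) : Prop :=
  forall (i : 'I_n) (c : 'I_2), 0 <= P i c <= 1.

Definition triple (n : nat) :=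
  {t : 'I_n * 'I_n * 'I_n | (t.1.1 < t.1.2)%N && (t.1.2 < t.2)%N}.

Definition tri_i (n : nat) (t : triple n) : 'I_n := (val t).1.1.
Definition tri_j (n : nat) (t : triple n) : 'I_n := (val t).1.2.
Definition tri_k (n : nat) (t : triple n) : 'I_n := (val t).2.

Definition signed_det (R : realType) (n : nat) (P : 'M[R]_(n, 2))
    (t : triple n) : R :=
  \det (row_mx (vertex P (tri_j t) - vertex P (tri_i t))
               (vertex P (tri_k t) - vertex P (tri_i t)) : 'M[R]_2).

Definition area (R : realType) (n : nat) (P : 'M[R]_(n, 2)) (t : triple n)
    : R :=
  2^-1 * `|signed_det P t|.

(* The infimum of a finite family, hence a minimum as soon as a triple exists,
   i.e. for n >= 3; see [min_areaP]. *)
Definition min_area (R : realType) (n : nat) (P : 'M[R]_(n, 2)) : R :=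
  inf (range (area P)).

Lemma min_areaP (R : realType) (n : nat) (P : 'M[R]_(n, 2)) :
  (3 <= n)%N ->
  (exists t : triple n, area P t = min_area P) /\
  (forall t : triple n, min_area P <= area P t).
Proof.
case: n P => [|[|[|n]]] // P _.
have [t0 _] : exists t : triple n.+3, true.
  pose t := (inord 0, inord 1, inord 2) : 'I_n.+3 * 'I_n.+3 * 'I_n.+3.
  have tP : (t.1.1 < t.1.2)%N && (t.1.2 < t.2)%N by rewrite /= !inordK.
  by exists (Sub t tP).
have lb t : min_area P <= area P t.
  apply: ge_inf; last by exists t.
  by exists 0 => _ [s _ <-]; rewrite /area mulr_ge0 // invr_ge0.
split=> //.
case: (@Order.TotalTheory.arg_minP _ _ _ t0 xpredT (area P)) => // t _ tmin.
exists t; apply/eqP; rewrite eq_le lb andbT.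
by apply: lb_le_inf; [exists (area P t0), t0 | move=> _ [s _ <-]; exact: tmin].
Qed.

Definition positive_area_local_optimum (R : realType) (n : nat)
    (P : 'M[R]_(n, 2)) : Prop :=
  [/\ in_unit_square P,
      \forall Q \near P, in_unit_square Q -> min_area Q <= min_area P &
      0 < min_area P].

Definition tight (R : realType) (n : nat) (P : 'M[R]_(n, 2)) (t : triple n)
    : bool :=
  area P t == min_area P.

Definition vec2 (R : realType) (a b : R) : 'cV[R]_2 :=
  \col_(c < 2) (if c == 0 then a else b).

(* The gradient of the area of t with respect to p_i, as the vector of the
   partial derivatives in the directions of the coordinates x_i and y_i. *)
Definition grad_area (R : realType) (n : nat) (P : 'M[R]_(n, 2))
    (t : triple n) (i : 'I_n) : 'cV[R]_2 :=
  \col_(c < 2)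
    'D_(delta_mx i c : 'M[R]_(n, 2)) (fun Q : 'M[R]_(n, 2) => area Q t) P.

Record multiplier (R : realType) (n : nat) := Multiplier {
  mul_tri : triple n -> R;
  mul_left : 'I_n -> R;
  mul_right : 'I_n -> R;
  mul_down : 'I_n -> R;
  mul_up : 'I_n -> R
}.

Record normalized_KKT (R : realType) (n : nat) (P : 'M[R]_(n, 2))
    (theta : multiplier R n) : Prop := NormalizedKKT {
  kkt_tri_ge0 : forall t, 0 <= mul_tri theta t;
  kkt_left_ge0 : forall i, 0 <= mul_left theta i;
  kkt_right_ge0 : forall i, 0 <= mul_right theta i;
  kkt_down_ge0 : forall i, 0 <= mul_down theta i;
  kkt_up_ge0 : forall i, 0 <= mul_up theta i;
  kkt_tri_supp : forall t, ~~ tight P t -> mul_tri theta t = 0;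
  kkt_left_supp : forall i, P i 0 != 0 -> mul_left theta i = 0;
  kkt_right_supp : forall i, P i 0 != 1 -> mul_right theta i = 0;
  kkt_down_supp : forall i, P i 1 != 0 -> mul_down theta i = 0;
  kkt_up_supp : forall i, P i 1 != 1 -> mul_up theta i = 0;
  kkt_sum : \sum_(t : triple n) mul_tri theta t = 1;
  kkt_stationary : forall i,
    \sum_(t : triple n) mul_tri theta t *: grad_area P t i
    + vec2 (mul_left theta i - mul_right theta i)
           (mul_down theta i - mul_up theta i) = 0
}.

Definition elementary_stress (R : realType) (n : nat) (P : 'M[R]_(n, 2))
    (t : triple n) : 'M[R]_n :=
  let e (i : 'I_n) : 'cV[R]_n := delta_mx i 0 in
  let a := e (tri_j t) - e (tri_i t) in
  let c := e (tri_k t) - e (tri_i t) in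
  Num.sg (signed_det P t) *: (a *m c^T - c *m a^T).

Definition stress (R : realType) (n : nat) (P : 'M[R]_(n, 2))
    (theta : multiplier R n) (H : {set triple n}) : 'M[R]_n :=
  \sum_(t in H) mul_tri theta t *: elementary_stress P t.

Definition mass (R : realType) (n : nat) (theta : multiplier R n)
    (H : {set triple n}) : R :=
  \sum_(t in H) mul_tri theta t.

(* The identification of R^2 with C, applied to each row of an n x 2 matrix. *)
Definition complexify (R : realType) (n : nat) (P : 'M[R]_(n, 2))
    : 'cV[R[i]]_n :=
  \col_i (P i 0 +i* P i 1)%C.

(* Main.v *)
(** The column sums of each elementary stress vanish, and, with [J] the rotation
    matrix [[0, 1], [-1, 0]], the antisymmetric form [a c^T - c a^T] of two plane
    vectors is [det(a, c) J]; hence [P^T B_t P = s_t D_t J = 2 A_t J].  Separating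
    real and imaginary parts in [B z = 2 i b] gives [b = (1/2) B P J^T], and
    [J J^T = 1] then yields [P^T b = sum_t lambda_t A_t I], where [A_t] is the
    minimal area on tight triangles. *)
Require Import Defs.
From mathcomp Require Import all_boot all_order all_algebra.
From mathcomp Require Import all_classical all_reals all_analysis.
From mathcomp Require Import ring.

Set Implicit Arguments.
Unset Strict Implicit.
Unset Printing Implicit Defensive.

Import Order.TTheory GRing.Theory Num.Theory.
Import numFieldNormedType.Exports.

Local Open Scope ring_scope.

(** The entry formula [j - i] gives the matrix J. On row vectors, right multiplication by its
    transpose sends (u, v) to (v, -u), which is multiplication by -i in the complex plane. *)
Definition plane_rot (R : nzRingType) : 'M[R]_2 :=
  \matrix_(i < 2, j < 2) (j%:R - i%:R).

Lemma ord2P (i : 'I_2) : i = 0 \/ i = 1.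
Proof. by case: i => [[|[|//]] ?]; [left|right]; apply: val_inj. Qed.

Lemma plane_rotK (R : comNzRingType) :
  plane_rot R *m (plane_rot R)^T = 1%:M.
Proof.
apply/matrixP => i j; rewrite !mxE big_ord_recl big_ord1 !mxE.
by case: (ord2P i) => ->; case: (ord2P j) => ->;
  rewrite /= /bump /= ?modn_small //; ring.
Qed.

Lemma det_mx22 (R : comNzRingType) (A : 'M[R]_2) :
  \det A = A 0 0 * A 1 1 - A 0 1 * A 1 0.
Proof.
have lift0 : lift 0 0 = 1 :> 'I_2 by apply: val_inj.
have lift1 : lift 1 0 = 0 :> 'I_2 by apply: val_inj.
rewrite (expand_det_row _ 0) big_ord_recl big_ord1 /cofactor !det_mx11 !mxE.
by rewrite !lift0 !lift1 /=; ring.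
Qed.

(** Antisymmetric 2 by 2 matrices are multiples of J, the factor being the upper right entry, here
    a_0 c_1 - c_0 a_1. *)
Lemma wedge_plane (R : comNzRingType) (a c : 'cV[R]_2) :
  a *m c^T - c *m a^T = \det (row_mx a c : 'M[R]_2) *: plane_rot R.
Proof.
have mxl i : (row_mx a c : 'M[R]_2) i 0 = a i 0.
  by rewrite -(row_mxEl a c i 0); congr (row_mx a c _ _); apply: val_inj.
have mxr i : (row_mx a c : 'M[R]_2) i 1 = c i 0.
  by rewrite -(row_mxEr a c i 0); congr (row_mx a c _ _); apply: val_inj.
apply/matrixP => i j.
rewrite det_mx22 !mxl !mxr !mxE !big_ord1 !mxE.
by case: (ord2P i) => ->; case: (ord2P j) => ->;
  rewrite /= /bump /= ?modn_small //; ring.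
Qed.

Section Stress.
Variables (R : realType) (n : nat).
Implicit Types (P b : 'M[R]_(n, 2)) (t : triple n) (H : {set triple n}).

Lemma vertexE P i : vertex P i = P^T *m delta_mx i 0.
Proof. by rewrite /vertex rowE trmx_mul trmx_delta. Qed.

Lemma sum_vertex P : \sum_(i < n) vertex P i = P^T *m const_mx 1.
Proof.
apply/matrixP => c j; rewrite summxE !mxE.
by apply: eq_bigr => i _; rewrite !mxE mulr1.
Qed.

Lemma sum_vertex_mul P b :
  \sum_(i < n) vertex P i *m (vertex b i)^T = P^T *m b.
Proof.
apply/matrixP => c d; rewrite summxE !mxE.
by apply: eq_bigr => i _; rewrite !mxE big_ord1 !mxE.
Qed.

Lemma ones_delta_mx (i : 'I_n) :
  (const_mx 1 : 'rV[R]_n) *m delta_mx i (0 : 'I_1) = 1%:M.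
Proof.
by rewrite -colE; apply/matrixP => x y; rewrite !ord1 !mxE.
Qed.

(** Both [a] and [c] are differences of basis vectors, so their coordinates sum to zero. *)
Lemma ones_elementary_stress P t :
  (const_mx 1 : 'rV[R]_n) *m elementary_stress P t = 0.
Proof.
rewrite /elementary_stress -scalemxAr mulmxBr !mulmxA !mulmxBr !ones_delta_mx.
by rewrite !subrr !mul0mx subrr scaler0.
Qed.

Lemma ones_stress P theta H : (const_mx 1 : 'rV[R]_n) *m stress P theta H = 0.
Proof.
rewrite /stress mulmx_sumr big1 // => t _.
by rewrite -scalemxAr ones_elementary_stress scaler0.
Qed.

Lemma elementary_stress_form P t :
  P^T *m elementary_stress P t *m P = (2 * area P t) *: plane_rot R.
Proof.
(* [P^T] maps the index vectors [a] and [c] to the edge vectors of the triangle. *)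
have edgeE i j : vertex P j - vertex P i = P^T *m (delta_mx j 0 - delta_mx i 0).
  by rewrite !vertexE mulmxBr.
have -> : 2 * area P t = Num.sg (signed_det P t) * signed_det P t.
  by rewrite /area mulVKf ?pnatr_eq0 // -normrEsg.
rewrite -scalerA -wedge_plane !edgeE /elementary_stress.
rewrite -scalemxAr -scalemxAl mulmxBr mulmxBl; congr (_ *: _).
by rewrite !trmx_mul !trmxK !mulmxA.
Qed.

Lemma stress_form P theta H :
  (forall t, t \in H -> tight P t) ->
  P^T *m stress P theta H *m P
  = (2 * (mass theta H * min_area P)) *: plane_rot R.
Proof.
move=> tightH; rewrite /stress /mass mulmx_sumr mulmx_suml.
(* Tightness lets the common minimal area be replaced by the area of each [t]. *)
rewrite mulr_suml mulr_sumr scaler_suml; apply: eq_bigr => t /tightH /eqP <-.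
by rewrite -scalemxAr -scalemxAl elementary_stress_form scalerA mulrCA.
Qed.

(** A real [B] acts separately on real and imaginary parts, and division by 2i is half of
    multiplication by -i, that is, [2^-1] times the transpose of J on rows. *)
Lemma complexify_stressE (B : 'M[R]_n) P b :
  map_mx (real_complex R) B *m complexify P = (2 * 'i%C) *: complexify b ->
  b = 2^-1 *: (B *m P *m (plane_rot R)^T).
Proof.
move=> hb.
have entry i : ((B *m P) i 0 +i* (B *m P) i 1)%C
             = ((- (2 * b i 1)) +i* (2 * b i 0))%C.
  have := congr1 (fun M : 'cV_n => M i 0) hb; rewrite !mxE.
  have -> : (2 * 'i%C * (b i 0 +i* b i 1) = (- (2 * b i 1)) +i* (2 * b i 0))%C.
    by apply/eqP; rewrite eq_complex /=; apply/andP; split; apply/eqP; ring.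
  move=> <-; apply/eqP; rewrite eq_complex /=.
  rewrite !raddf_sum /=; apply/andP; split; apply/eqP; apply: eq_bigr => j _;
    by rewrite !mxE /= mul0r ?subr0 ?addr0.
have half (x : R) : 2^-1 * (2 * x) = x.
  by rewrite mulKf ?pnatr_eq0.
apply/matrixP => i c; have [re im] := entry i.
rewrite mxE [in RHS]mxE big_ord_recl big_ord1.
rewrite (_ : lift ord0 ord0 = 1); last exact: val_inj.
rewrite re im !mxE.
case: (ord2P c) => ->; rewrite -[LHS]half; congr (_ * _);
  by rewrite /= ?modn_small //; ring.
Qed.

End Stress.

Theorem theorem3p2 (R : realType) (n : nat) (hn : (3 <= n)%N)
  (P : 'M[R]_(n, 2)) (hP : positive_area_local_optimum P)
  (theta : multiplier R n) (htheta : normalized_KKT P theta)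
  (H : {set triple n}) (hH : forall t : triple n, t \in H -> tight P t)
  (b : 'M[R]_(n, 2))
  (hb : map_mx (real_complex R) (stress P theta H) *m complexify P
        = (2 * 'i%C) *: complexify b) :
  \sum_(i < n) vertex b i = 0 /\
  \sum_(i < n) vertex P i *m (vertex b i)^T
    = (mass theta H * min_area P)%:M.
Proof.
rewrite sum_vertex sum_vertex_mul (complexify_stressE hb); split.
  (* Transposing brings the all-ones row to the left of the stress, which it annihilates. *)
  apply: trmx_inj; rewrite trmx_mul trmxK trmx_const trmx0 -scalemxAr !mulmxA.
  by rewrite ones_stress !mul0mx scaler0.
(* The factor 1/2 in [b] cancels the 2 in [stress_form]. *)
rewrite -scalemxAr !mulmxA (stress_form theta hH) -scalemxAl plane_rotK scalerA.
by rewrite mulKf ?pnatr_eq0 // scalemx1.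
Qed.
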